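(* Let $\mathbb{F}=(\mathbb{P},R_\Box,R_\Diamond)$ be an enriched formal context with $\mathbb{P}=(G,M,I)$, and let $V:\mathrm{P}\to\mathbb{P}^+$ be a valuation. Then for every formula $\varphi\in\mathcal{L}$ and every $g\in G$ (resp. $m\in M$): $V,g\Vdash\varphi$ (resp. $V,m\not\succ\varphi$) if and only if $\exists$ has a winning strategy in the evaluation game on $\mathbb{F}$ (with valuation $V$) starting from position $(g,\varphi)$ (resp. $(m,\varphi)$).
   Context: Language: $\mathcal{L}$ is given by $\varphi::=\bot\mid\top\mid p\mid\varphi\wedge\varphi\mid\varphi\vee\varphi\mid\Box\varphi\mid\Diamond\varphi$ with $p$ ranging over a countable set $\mathrm{P}$ of atoms. Polarities: a polarity is $\mathbb{P}=(G,M,I)$ with $I\subseteq G\times M$. For a relation $T\subseteq U\times W$, $U'\subseteq U$, $W'\subseteq W$, put $T^{(1)}[U']=\{w\mid \forall u\in U'\ uTw\}$ and $T^{(0)}[W']=\{u\mid\forall w\in W'\ uTw\}$ (singletons written without braces). Let $B^\uparrow=I^{(1)}[B]$ for $B\subseteq G$ and $Y^\downarrow=I^{(0)}[Y]$ for $Y\subseteq M$; a set is Galois-stable if it is a fixed point of $(\cdot)^{\uparrow\downarrow}$ resp. $(\cdot)^{\downarrow\uparrow}$. A formal concept is a pair $c=(B,Y)$ with $B=Y^\downarrow$, $Y=B^\uparrow$; write $[\![c]\!]=B$ (extension) and $(\![c]\!)=Y$ (intension). Concepts ordered by $c_1\le c_2$ iff $[\![c_1]\!]\subseteq[\![c_2]\!]$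 form a complete lattice $\mathbb{P}^+$. An enriched formal context is $\mathbb{F}=(\mathbb{P},R_\Box,R_\Diamond)$ with $R_\Box\subseteq G\times M$, $R_\Diamond\subseteq M\times G$ $I$-compatible, i.e. $R_\Box^{(0)}[m]$, $R_\Box^{(1)}[g]$, $R_\Diamond^{(0)}[g]$, $R_\Diamond^{(1)}[m]$ are Galois-stable for all $g\in G,m\in M$. On $\mathbb{P}^+$ define $[R_\Box]c=(R_\Box^{(0)}[(\![c]\!)],I^{(1)}[R_\Box^{(0)}[(\![c]\!)]])$ and $\langle R_\Diamond\rangle c=(I^{(0)}[R_\Diamond^{(0)}[[\![c]\!]]],R_\Diamond^{(0)}[[\![c]\!]])$. Semantics: a valuation $V:\mathrm{P}\to\mathbb{P}^+$ is extended to all formulas by interpreting $\top,\bot,\wedge,\vee$ as top, bottom, meet, join of $\mathbb{P}^+$, $\Box$ as $[R_\Box]$ and $\Diamond$ as $\langle R_\Diamond\rangle$. Then $V,g\Vdash\varphi$ iff $g\in[\![V(\varphi)]\!]$ and $V,m\succ\varphi$ iff $m\in(\![V(\varphi)]\!)$. Game: two players $\exists$ and $\forall$. A play is a sequence of positions where each next position is an admissible move chosen by the player owning the current position; a player who must move but has no admissible move loses; infinite plays are won by $\forall$. A strategy for a player assigns to each partial play ending in a position of that player an admissible move; it is winning from a position if every play from that position following it is won by that player. Writing $I^c=(G\times M)\setminus I$, $R_\Box^c=(G\times M)\setminus R_\Box$, $R_\Diamond^c=(M\times G)\setminus R_\Diamond$, positions are pairs $(g,\varphi)$, $(m,\varphi)$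 with the following owners and admissible moves: $(g,p)$ with $V,g\Vdash p$: $\forall$, no moves; $(g,p)$ with $V,g\not\Vdash p$: $\forall$, $\{(m,p)\mid gI^cm\}$; $(m,p)$ with $V,m\succ p$: $\exists$, no moves; $(m,p)$ with $V,m\not\succ p$: $\exists$, $\{(g,p)\mid gI^cm\}$; $(g,\top)$: $\forall$, no moves; $(m,\bot)$: $\exists$, no moves; $(g,\bot)$: $\forall$, $\{(m,\bot)\mid gI^cm\}$; $(m,\top)$: $\exists$, $\{(g,\top)\mid gI^cm\}$; $(m,\varphi_1\vee\varphi_2)$: $\exists$, $\{(m,\varphi_1),(m,\varphi_2)\}$; $(g,\varphi_1\vee\varphi_2)$: $\forall$, $\{(m,\varphi_1\vee\varphi_2)\mid gI^cm\}$; $(g,\varphi_1\wedge\varphi_2)$: $\forall$, $\{(g,\varphi_1),(g,\varphi_2)\}$; $(m,\varphi_1\wedge\varphi_2)$: $\exists$, $\{(g,\varphi_1\wedge\varphi_2)\mid gI^cm\}$; $(m,\Diamond\varphi)$: $\exists$, $\{(g,\varphi)\mid mR_\Diamond^cg\}$; $(g,\Diamond\varphi)$: $\forall$, $\{(m,\Diamond\varphi)\mid gI^cm\}$; $(g,\Box\varphi)$: $\forall$, $\{(m,\varphi)\mid gR_\Box^cm\}$; $(m,\Box\varphi)$: $\exists$, $\{(g,\Box\varphi)\mid gI^cm\}$. *)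

(* Defs.v *)
From HB Require Import structures.
From mathcomp Require Import all_boot all_order.
From mathcomp Require Import boolp classical_sets.

Set Implicit Arguments.
Unset Strict Implicit.
Unset Printing Implicit Defensive.

Import Order.TTheory.
Local Open Scope classical_set_scope.

(* [polar1 T U] is T^(1)[U] and [polar0 T W] is T^(0)[W]. *)
Definition polar1 (A B : Type) (T : A -> B -> Prop) (U : set A) : set B :=
  [set w | forall u, U u -> T u w].

Definition polar0 (A B : Type) (T : A -> B -> Prop) (W : set B) : set A :=
  [set u | forall w, W w -> T u w].

Record polarity := Polarity {
  obj : Type;
  feat : Type;
  inc : obj -> feat -> Prop
}.

Definition up (P : polarity) (B : set (obj P)) : set (feat P) :=
  polar1 (@inc P) B.

Definition down (P : polarity) (Y : set (feat P)) : set (obj P) :=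
  polar0 (@inc P) Y.

Definition obj_stable (P : polarity) (B : set (obj P)) : Prop :=
  down (up B) = B.

Definition feat_stable (P : polarity) (Y : set (feat P)) : Prop :=
  up (down Y) = Y.

Record concept (P : polarity) := Concept {
  extension : set (obj P);
  intension : set (feat P);
  extensionE : extension = down intension;
  intensionE : intension = up extension
}.

Lemma concept_eq (P : polarity) (c d : concept P) :
  extension c = extension d -> c = d.
Proof.
case: c d => [B Y e i] [B' Y' e' i'] /= EB.
have EY : Y = Y' by rewrite i i' EB.
move: e i e' i'; rewrite -EB -EY => e i e' i'.
by rewrite (Prop_irrelevance e e') (Prop_irrelevance i i').
Qed.

Lemma sub_down_up (P : polarity) (B : set (obj P)) : B `<=` down (up B).
Proof. by move=> g Bg m; apply. Qed.

Lemma sub_up_down (P : polarity) (Y : set (feat P)) : Y `<=` up (down Y).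
Proof. by move=> m Ym g; apply. Qed.

Lemma up_anti (P : polarity) (B C : set (obj P)) : B `<=` C -> up C `<=` up B.
Proof. by move=> BC m h g /BC; apply: h. Qed.

Lemma down_anti (P : polarity) (Y Z : set (feat P)) :
  Y `<=` Z -> down Z `<=` down Y.
Proof. by move=> YZ g h m /YZ; apply: h. Qed.

Lemma down_up_down (P : polarity) (Y : set (feat P)) : down Y = down (up (down Y)).
Proof.
apply/seteqP; split; first exact: sub_down_up.
exact/down_anti/sub_up_down.
Qed.

Lemma up_down_up (P : polarity) (B : set (obj P)) : up B = up (down (up B)).
Proof.
apply/seteqP; split; first exact: sub_up_down.
exact/up_anti/sub_down_up.
Qed.

Lemma subset_intension (P : polarity) (c d : concept P) :
  extension c `<=` extension d <-> intension d `<=` intension c.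
Proof.
split.
- by rewrite (intensionE c) (intensionE d); exact: up_anti.
- by rewrite (extensionE c) (extensionE d); exact: down_anti.
Qed.

Definition concept_of_obj (P : polarity) (B : set (obj P))
    (hB : obj_stable B) : concept P :=
  @Concept P B (up B) (esym hB) erefl.

Definition concept_of_feat (P : polarity) (Y : set (feat P))
    (hY : feat_stable Y) : concept P :=
  @Concept P (down Y) Y erefl (esym hY).

Definition concept_le (P : polarity) (c d : concept P) : bool :=
  `[< extension c `<=` extension d >].

Lemma obj_stableT (P : polarity) : obj_stable (@setT (obj P)).
Proof. by apply/seteqP; split=> // g _; apply: sub_down_up. Qed.

Lemma feat_stableT (P : polarity) : feat_stable (@setT (feat P)).
Proof. by apply/seteqP; split=> // g _; apply: sub_up_down. Qed.

Lemma obj_stableI (P : polarity) (c d : concept P) :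
  obj_stable (extension c `&` extension d).
Proof.
apply/seteqP; split; last exact: sub_down_up.
move=> g h; split.
- rewrite (extensionE c) => m; rewrite (intensionE c) => hm.
  by apply: h => g' [cg' _]; apply: hm.
- rewrite (extensionE d) => m; rewrite (intensionE d) => hm.
  by apply: h => g' [_ dg']; apply: hm.
Qed.

Lemma feat_stableI (P : polarity) (c d : concept P) :
  feat_stable (intension c `&` intension d).
Proof.
apply/seteqP; split; last exact: sub_up_down.
move=> m h; split.
- rewrite (intensionE c) => g; rewrite (extensionE c) => hg.
  by apply: h => m' [cm' _]; apply: hg.
- rewrite (intensionE d) => g; rewrite (extensionE d) => hg.
  by apply: h => m' [_ dm']; apply: hg.
Qed.

Definition concept_top (P : polarity) : concept P :=
  concept_of_obj (@obj_stableT P).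

Definition concept_bot (P : polarity) : concept P :=
  concept_of_feat (@feat_stableT P).

Definition concept_meet (P : polarity) (c d : concept P) : concept P :=
  concept_of_obj (obj_stableI c d).

Definition concept_join (P : polarity) (c d : concept P) : concept P :=
  concept_of_feat (feat_stableI c d).

Lemma concept_le_refl (P : polarity) : reflexive (@concept_le P).
Proof. by move=> c; apply/asboolP. Qed.

Lemma concept_le_anti (P : polarity) : antisymmetric (@concept_le P).
Proof.
by move=> c d /andP[/asboolP cd /asboolP dc]; apply: concept_eq; apply/seteqP.
Qed.

Lemma concept_le_trans (P : polarity) : transitive (@concept_le P).
Proof.
move=> d c e /asboolP cd /asboolP de; apply/asboolP.
exact: subset_trans cd de.
Qed.

Lemma concept_meetP (P : polarity) (c d e : concept P) :
  concept_le c (concept_meet d e) = concept_le c d && concept_le c e.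
Proof.
apply/asboolP/andP => [h|[/asboolP h1 /asboolP h2]].
- by split; apply/asboolP => g /h [].
- by move=> g cg; split; [apply: h1|apply: h2].
Qed.

Lemma concept_joinP (P : polarity) (c d e : concept P) :
  concept_le (concept_join c d) e = concept_le c e && concept_le d e.
Proof.
apply/asboolP/andP => [/subset_intension h|[]].
- by split; apply/asboolP/subset_intension => m /h [].
- move=> /asboolP/subset_intension h1 /asboolP/subset_intension h2.
  by apply/subset_intension => m em; split; [apply: h1|apply: h2].
Qed.

Lemma concept_le0x (P : polarity) (c : concept P) :
  concept_le (concept_bot P) c.
Proof. exact/asboolP/subset_intension. Qed.

Lemma concept_lex1 (P : polarity) (c : concept P) :
  concept_le c (concept_top P).
Proof. exact/asboolP. Qed.

Fact concept_display : Order.disp_t. Proof. exact: Order.Disp tt tt. Qed.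

HB.instance Definition _ (P : polarity) := gen_eqMixin (concept P).
HB.instance Definition _ (P : polarity) := gen_choiceMixin (concept P).
HB.instance Definition _ (P : polarity) :=
  Order.Le_isPOrder.Build concept_display (concept P)
    (@concept_le_refl P) (@concept_le_anti P) (@concept_le_trans P).
HB.instance Definition _ (P : polarity) :=
  Order.POrder_MeetJoin_isLattice.Build concept_display (concept P)
    (@concept_meetP P) (@concept_joinP P).
HB.instance Definition _ (P : polarity) :=
  Order.hasBottom.Build concept_display (concept P) (@concept_le0x P).
HB.instance Definition _ (P : polarity) :=
  Order.hasTop.Build concept_display (concept P) (@concept_lex1 P).

Record enriched_context := EnrichedContext {
  base :> polarity;
  rbox : obj base -> feat base -> Prop;
  rdia : feat base -> obj base -> Prop;
  rbox_compat0 : forall m, obj_stable (polar0 rbox [set m]);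
  rbox_compat1 : forall g, feat_stable (polar1 rbox [set g]);
  rdia_compat0 : forall g, feat_stable (polar0 rdia [set g]);
  rdia_compat1 : forall m, obj_stable (polar1 rdia [set m])
}.

Lemma rbox_stable (F : enriched_context) (Y : set (feat F)) :
  obj_stable (polar0 (@rbox F) Y).
Proof.
apply/seteqP; split; last exact: sub_down_up.
move=> g h m Ym.
have : polar0 (@rbox F) [set m] g.
  rewrite -(rbox_compat0 m); move: g h; apply: down_anti; apply: up_anti.
  by move=> g' h' m' ->; apply: h'.
by apply.
Qed.

Lemma rdia_stable (F : enriched_context) (B : set (obj F)) :
  feat_stable (polar0 (@rdia F) B).
Proof.
apply/seteqP; split; last exact: sub_up_down.
move=> m h g Bg.
have : polar0 (@rdia F) [set g] m.
  rewrite -(rdia_compat0 g); move: m h; apply: up_anti; apply: down_anti.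
  by move=> m' h' g' ->; apply: h'.
by apply.
Qed.

Definition box_op (F : enriched_context) (c : concept F) : concept F :=
  concept_of_obj (rbox_stable (intension c)).

Definition dia_op (F : enriched_context) (c : concept F) : concept F :=
  concept_of_feat (rdia_stable (extension c)).

Inductive formula (Prp : Type) :=
  | fBot
  | fTop
  | fAtom of Prp
  | fAnd of formula Prp & formula Prp
  | fOr of formula Prp & formula Prp
  | fBox of formula Prp
  | fDia of formula Prp.
Arguments fBot {Prp}.
Arguments fTop {Prp}.

Fixpoint interp (Prp : Type) (F : enriched_context) (V : Prp -> concept F)
    (phi : formula Prp) : concept F :=
  match phi with
  | fBot => \bot%O
  | fTop => \top%O
  | fAtom p => V p
  | fAnd phi1 phi2 => (interp V phi1 `&` interp V phi2)%O
  | fOr phi1 phi2 => (interp V phi1 `|` interp V phi2)%O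
  | fBox psi => box_op (interp V psi)
  | fDia psi => dia_op (interp V psi)
  end.

(* V, g ||- phi *)
Definition supports (Prp : Type) (F : enriched_context) (V : Prp -> concept F)
    (g : obj F) (phi : formula Prp) : Prop :=
  extension (interp V phi) g.

(* V, m >- phi *)
Definition refutes (Prp : Type) (F : enriched_context) (V : Prp -> concept F)
    (m : feat F) (phi : formula Prp) : Prop :=
  intension (interp V phi) m.

Inductive player := Eloise | Abelard.

Definition opponent (a : player) : player :=
  match a with Eloise => Abelard | Abelard => Eloise end.

Record game := Game {
  position : Type;
  owner : position -> player;
  moves : position -> set position
}.

Definition movable (X : game) (q : position X) : Prop := moves q !=set0.

(* Nonempty sequences of positions are given by head and tail, as in [path]. *)
Definition partial_play (X : game) (x : position X) (s : seq (position X)) :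
    bool :=
  path (fun q q' : position X => `[< moves q q' >]) x s.

Inductive play (X : game) :=
  | FinPlay (x : position X) (s : seq (position X))
  | InfPlay (f : nat -> position X).

(* A finite play must end in a dead end; maximal plays only are considered. *)
Definition is_play (X : game) (pi : play X) : Prop :=
  match pi with
  | FinPlay x s => partial_play x s /\ ~ movable (last x s)
  | InfPlay f => forall i, moves (f i) (f i.+1)
  end.

Definition starts_at (X : game) (pi : play X) (q : position X) : Prop :=
  match pi with
  | FinPlay x _ => x = q
  | InfPlay f => f 0 = q
  end.

Definition winner (X : game) (pi : play X) : player :=
  match pi with
  | FinPlay x s => opponent (owner (last x s))
  | InfPlay _ => Abelard
  end.

(* A strategy is a function of the whole history.  It is constrained only on
   partial plays ending in a position owned by [a] where some move is available;
   its other values are irrelevant. *)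
Definition is_strategy (X : game) (a : player)
    (sigma : seq (position X) -> position X) : Prop :=
  forall (x : position X) (s : seq (position X)),
    partial_play x s -> owner (last x s) = a -> movable (last x s) ->
    moves (last x s) (sigma (x :: s)).

Definition follows (X : game) (a : player)
    (sigma : seq (position X) -> position X) (pi : play X) : Prop :=
  match pi with
  | FinPlay x s => forall i, i < size s ->
      owner (nth x (x :: s) i) = a ->
      nth x (x :: s) i.+1 = sigma (take i.+1 (x :: s))
  | InfPlay f => forall i,
      owner (f i) = a -> f i.+1 = sigma (mkseq f i.+1)
  end.

Definition winning_from (X : game) (a : player)
    (sigma : seq (position X) -> position X) (q : position X) : Prop :=
  forall pi : play X,
    is_play pi -> starts_at pi q -> follows a sigma pi -> winner pi = a.

Definition has_winning_strategy (X : game) (a : player) (q : position X) :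
    Prop :=
  exists2 sigma : seq (position X) -> position X,
    is_strategy a sigma & winning_from a sigma q.

Inductive eval_position (Prp : Type) (F : enriched_context) :=
  | ObjPos of obj F & formula Prp
  | FeatPos of feat F & formula Prp.
Arguments ObjPos {Prp F}.
Arguments FeatPos {Prp F}.

(* In the table of positions, Abelard owns every (g, phi), Eloise every (m, phi). *)
Definition eval_owner (Prp : Type) (F : enriched_context)
    (q : eval_position Prp F) : player :=
  match q with ObjPos _ _ => Abelard | FeatPos _ _ => Eloise end.

(* The moves {(m, phi) | g I^c m} from (g, phi), resp. {(g, phi) | g I^c m}
   from (m, phi). *)
Definition to_feat (Prp : Type) (F : enriched_context) (g : obj F)
    (phi : formula Prp) : set (eval_position Prp F) :=
  [set FeatPos m phi | m in [set m | ~ inc g m]].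

Definition to_obj (Prp : Type) (F : enriched_context) (m : feat F)
    (phi : formula Prp) : set (eval_position Prp F) :=
  [set ObjPos g phi | g in [set g | ~ inc g m]].

Definition eval_moves (Prp : Type) (F : enriched_context) (V : Prp -> concept F)
    (q : eval_position Prp F) : set (eval_position Prp F) :=
  match q with
  | ObjPos g phi =>
      match phi with
      | fAtom p => if `[< supports V g (fAtom p) >] then set0 else to_feat g phi
      | fTop => set0
      | fBot => to_feat g phi
      | fOr _ _ => to_feat g phi
      | fAnd phi1 phi2 => [set ObjPos g phi1; ObjPos g phi2]
      | fDia _ => to_feat g phi
      | fBox psi => [set FeatPos m psi | m in [set m | ~ rbox g m]]
      end
  | FeatPos m phi =>
      match phi with
      | fAtom p => if `[< refutes V m (fAtom p) >] then set0 else to_obj m phi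
      | fBot => set0
      | fTop => to_obj m phi
      | fOr phi1 phi2 => [set FeatPos m phi1; FeatPos m phi2]
      | fAnd _ _ => to_obj m phi
      | fDia psi => [set ObjPos g psi | g in [set g | ~ rdia m g]]
      | fBox _ => to_obj m phi
      end
  end.

Definition eval_game (Prp : Type) (F : enriched_context)
    (V : Prp -> concept F) : game :=
  @Game (eval_position Prp F) (@eval_owner Prp F) (eval_moves V).

(* Main.v *)
Require Import Defs.
From mathcomp Require Import all_boot.
From mathcomp Require Import boolp classical_sets.

(** Call [(g, phi)] true when [g] supports [phi], and [(m, phi)] true when [m]
   does not refute [phi].  At a true position Eloise can keep the play at true
   positions, at a false one Abelard can keep it at false positions, and in both
   cases a natural number attached to positions decreases along the play.  So
   the play ends, at a position where the other player is stuck. *)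

Set Implicit Arguments.
Unset Strict Implicit.
Unset Printing Implicit Defensive.

(** * Regions with a decreasing rank in an arbitrary game *)

Record ranked_region (X : game) (a : player) (W : set (position X))
    (rk : position X -> nat) : Prop := RankedRegion {
  region_own : forall q, W q -> owner q = a ->
    exists2 q', moves q q' & W q' /\ rk q' < rk q;
  region_opp : forall q q', W q -> owner q = opponent a -> moves q q' ->
    W q' /\ rk q' < rk q
}.

Lemma opponentK : involutive opponent. Proof. by case. Qed.

Lemma opponent_neq (a : player) : opponent a <> a. Proof. by case: a. Qed.

Lemma eq_or_opponent (a b : player) : b = a \/ b = opponent a.
Proof. by case: a b => -[]; [left|right|right|left]. Qed.

Lemma no_infinite_descent (u : nat -> nat) : ~ (forall i, u i.+1 < u i).
Proof.
(* The bound is absurd at [i = u 0 + 1]. *)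
move=> du; suff bnd i : u i + i <= u 0.
  by have := bnd (u 0).+1; rewrite leqNgt addnS ltnS leq_addl.
elim: i => [|i IHi]; first by rewrite addn0.
by apply: leq_trans IHi; rewrite addnS -addSn leq_add2r.
Qed.

(** A positional strategy suffices: it picks moves given by [region_own]. The play then stays in
    [W], and its dead end cannot belong to [a], who always has a move there. *)
Lemma ranked_region_wins (X : game) (a : player) (W : set (position X))
    (rk : position X -> nat) (q : position X) :
  ranked_region a W rk -> W q -> has_winning_strategy a q.
Proof.
move=> [own opp] Wq.
(* Outside [W] any admissible move will do, but [is_strategy] constrains those positions too. *)
pose good p p' := moves p p' /\
  (W p -> owner p = a -> W p' /\ rk p' < rk p).
have /choice[f fP] p : exists p', movable p -> good p p'.
  have [[p' mp']|Nm] := pselect (movable p); last by exists p.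
  have [[Wp op]|Np] := pselect (W p /\ owner p = a).
    by have [r mr Hr] := own p Wp op; exists r.
  by exists p' => _; split=> // Wp op; case: Np.
have step p p' : W p -> moves p p' -> (owner p = a -> p' = f p) ->
    W p' /\ rk p' < rk p.
  move=> Wp mp Ep; have [oa|oo] := eq_or_opponent a (owner p).
    by rewrite (Ep oa); apply: (fP p _).2 => //; exists p'.
  exact: opp Wp oo mp.
(* Histories are nonempty, so the default [q] is never returned. *)
exists (fun h => f (last q h)).
  by move=> x s _ _ mv /=; case: (fP _ mv).
case=> [x s|u] /=; last first.
  move=> mu u0 fu; exfalso.
  have fuE i : owner (u i) = a -> u i.+1 = f (u i).
    have {2}<- : last q (mkseq u i.+1) = u i.
      by rewrite -nth_last size_mkseq nth_mkseq.
    exact: fu.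
  have Wu i : W (u i).
    by elim: i => [|i Wi]; [rewrite u0|case: (step _ _ Wi (mu i) (@fuE i))].
  apply: (@no_infinite_descent (rk \o u)) => i /=.
  by case: (step _ _ (Wu i) (mu i) (@fuE i)).
move=> [/(pathP x) ps dead] xq fs.
have Wn i : i <= size s -> W (nth x (x :: s) i).
  elim: i => [|i IHi] lt_i; first by rewrite /= xq.
  have /asboolP mi := ps i lt_i.
  (* The history consulted at index [i] includes that position, hence the length [i.+1]. *)
  have lastE : last q (take i.+1 (x :: s)) = nth x (x :: s) i.
    rewrite -nth_last size_takel ?ltnS 1?ltnW // nth_take //.
    by rewrite (set_nth_default x) //= ltnS ltnW.
  case: (step _ _ (IHi (ltnW lt_i)) mi) => // oi.
  exact: etrans (fs i lt_i oi) (congr1 f lastE).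
have Wl : W (last x s) by rewrite (last_nth x); apply: Wn.
have [oa|oo] := eq_or_opponent a (owner (last x s)); last first.
  by rewrite oo opponentK.
by case: dead; have [r mr _] := own _ Wl oa; exists r.
Qed.

(** Any strategy of the opponent is answered by moves inside [W]. The resulting play follows that
    strategy, is finite by the rank, and leaves the opponent stuck. *)
Lemma ranked_region_defeats (X : game) (a : player) (W : set (position X))
    (rk : position X -> nat) (q : position X) :
  ranked_region a W rk -> W q -> ~ has_winning_strategy (opponent a) q.
Proof.
move=> [own opp] Wq [sigma str win].
suff [s [ps fs oa]] : exists s, [/\ is_play (FinPlay q s),
    follows (opponent a) sigma (FinPlay q s)
    & owner (last q s) = opponent a].
  by have := win _ ps erefl fs; rewrite /= oa opponentK => /esym/opponent_neq.
have: exists s, [/\ partial_play q s,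
    follows (opponent a) sigma (FinPlay q s) & W (last q s)].
  by exists [::]; split.
(* Induction on the rank of the last position, over all partial plays reaching it. *)
case=> s; have [n] := ubnP (rk (last q s)).
elim: n s => // n IHn s; rewrite ltnS => le_n [ps fs Ws].
have extend r : moves (last q s) r -> W r -> rk r < rk (last q s) ->
    (owner (last q s) = opponent a -> r = sigma (q :: s)) ->
    exists s', [/\ is_play (FinPlay q s'),
      follows (opponent a) sigma (FinPlay q s')
      & owner (last q s') = opponent a].
  move=> mr Wr lt_r rE; apply: (IHn (rcons s r)).
    by rewrite last_rcons; apply: leq_trans le_n.
  split; rewrite ?last_rcons //.
    by rewrite /partial_play rcons_path; apply/andP; split=> //; apply/asboolP.
  (* At [i = size s] the move is [r], with history [q :: s]; smaller indices concern the old
     play. *)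
  move=> i; rewrite size_rcons ltnS leq_eqVlt -rcons_cons.
  rewrite nth_rcons /= => /orP[/eqP->|lt_i].
    rewrite ltnS leqnn nth_rcons ltnn eqxx -last_nth => /rE->.
    by rewrite -cats1 take_size_cat.
  rewrite ltnS (ltnW lt_i) nth_rcons lt_i => /(fs i lt_i) /= ->.
  by rewrite -cats1 takel_cat // ltnW.
have [oa|oo] := eq_or_opponent a (owner (last q s)).
  have [r mr [Wr lt_r]] := own _ Ws oa.
  by apply: (extend r) => //; rewrite oa => /esym/opponent_neq.
have [mv|dead] := pselect (movable (last q s)); last by exists s; split.
have mr := str _ _ ps oo mv.
by have [Wr lt_r] := opp _ _ Ws oo mr; apply: (extend _ mr).
Qed.

(** * Truth, falsity and rank in the evaluation game *)

Section EvaluationGame.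
Variables (Prp : Type) (F : enriched_context) (V : Prp -> concept F).

Lemma supports_refutes (g : obj F) (m : feat F) (phi : formula Prp) :
  supports V g phi -> refutes V m phi -> inc g m.
Proof. by rewrite /supports extensionE => sg; apply: sg. Qed.

(** The intension is the polar of the extension, so a failure yields a witness, and this witness is
    the move by which Eloise switches sides. *)
Lemma not_refutes (m : feat F) (phi : formula Prp) :
  ~ refutes V m phi -> exists2 g, ~ inc g m & supports V g phi.
Proof.
rewrite /refutes intensionE => /existsNP[g /not_implyP[sg ni]].
by exists g.
Qed.

Lemma not_supports (g : obj F) (phi : formula Prp) :
  ~ supports V g phi -> exists2 m, ~ inc g m & refutes V m phi.
Proof.
rewrite /supports extensionE => /existsNP[m /not_implyP[rm ni]].
by exists m.
Qed.

Definition true_position (q : position (eval_game V)) : Prop :=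
  match q with
  | ObjPos g phi => supports V g phi
  | FeatPos m phi => ~ refutes V m phi
  end.

Fixpoint formula_size (phi : formula Prp) : nat :=
  match phi with
  | fBot | fTop | fAtom _ => 0
  | fAnd phi1 phi2 | fOr phi1 phi2 =>
      (formula_size phi1 + formula_size phi2).+1
  | fBox psi | fDia psi => (formula_size psi).+1
  end.

Definition formula_of (q : position (eval_game V)) : formula Prp :=
  match q with ObjPos _ phi | FeatPos _ phi => phi end.

(* On an atom the winner [a] moves at most once, after which the opponent is
   stuck; hence the asymmetry between the players there. *)
Definition keeps_formula (a : player) (q : position (eval_game V)) : bool :=
  match q, a with
  | ObjPos _ (fBot | fOr _ _ | fDia _), _ => true
  | FeatPos _ (fTop | fAnd _ _ | fBox _), _ => true
  | ObjPos _ (fAtom _), Abelard => true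
  | FeatPos _ (fAtom _), Eloise => true
  | _, _ => false
  end.

(** Doubling the size leaves one unit for a switch of sides between two moves to subformulas. *)
Definition rank (a : player) (q : position (eval_game V)) : nat :=
  (formula_size (formula_of q)).*2 + keeps_formula a q.

Lemma rank_smaller (a : player) (q q' : position (eval_game V)) :
  formula_size (formula_of q) < formula_size (formula_of q') ->
  rank a q < rank a q'.
Proof.
rewrite /rank => lt_qq'; apply: ltn_addr.
by case: keeps_formula; rewrite ?addn1 ?addn0 ?ltn_Sdouble ?ltn_double.
Qed.

Lemma rank_same (a : player) (q q' : position (eval_game V)) :
  formula_of q = formula_of q' -> ~~ keeps_formula a q ->
  keeps_formula a q' -> rank a q < rank a q'.
Proof. by rewrite /rank => -> /negPf-> ->; rewrite ltn_add2l. Qed.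

Lemma true_region : ranked_region Eloise true_position (rank Eloise).
Proof.
split.
- case=> // m phi tm _; have [g ni sg] := not_refutes tm.
  have keep : moves (FeatPos m phi : position (eval_game V)) (ObjPos g phi) ->
      ~~ keeps_formula Eloise (ObjPos g phi) ->
      keeps_formula Eloise (FeatPos m phi) ->
      exists2 q', moves (FeatPos m phi : position (eval_game V)) q' &
        true_position q' /\ rank Eloise q' < rank Eloise (FeatPos m phi).
    by move=> mv nk k; exists (ObjPos g phi); last split; last exact: rank_same.
  case: phi tm sg keep => [|| p |phi1 phi2|phi1 phi2|psi|psi] tm sg keep.
  + by case: tm.
  + by apply: keep => //; exists g.
  + by apply: keep => //=; case: asboolP => // _; exists g.
  + by apply: keep => //; exists g.
  (* The intension of a join is an intersection by conversion, so one disjunct is not refuted. *)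
  + have /not_andP[tm1|tm2] := tm.
      exists (FeatPos m phi1); first by left.
      by split=> //; apply: rank_smaller; rewrite ltnS leq_addr.
    exists (FeatPos m phi2); first by right.
    by split=> //; apply: rank_smaller; rewrite ltnS leq_addl.
  + by apply: keep => //; exists g.
  (* Failure of the universal condition defining the intension of [fDia psi] gives Eloise's move. *)
  + have /existsNP[h /not_implyP[sh nr]] := tm.
    exists (ObjPos h psi); first by exists h.
    by split=> //; apply: rank_smaller.
- case=> // g phi q' tg _ mq.
  have keep : to_feat g phi q' ->
      (forall m, ~~ keeps_formula Eloise (FeatPos m phi)) ->
      keeps_formula Eloise (ObjPos g phi) ->
      true_position q' /\ rank Eloise q' < rank Eloise (ObjPos g phi).
    case=> m ni <- nk k; split; last exact: rank_same.
    by move=> rm; apply: ni; apply: supports_refutes rm.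
  (* [keep] settles the side switches, and also [fTop], where [mq] is contradictory. *)
  case: phi tg mq keep => [|| p |phi1 phi2|phi1 phi2|psi|psi] tg mq keep;
    try exact: keep.
  + by move: mq => /=; case: asboolP.
  + have [tg1 tg2] : supports V g phi1 /\ supports V g phi2 := tg.
    case: mq => ->; split=> //; apply: rank_smaller.
      by rewrite ltnS leq_addr.
    by rewrite ltnS leq_addl.
  + case: mq => m nr <-; split; last exact: rank_smaller.
    by move=> rm; apply: nr; apply: tg.
Qed.

(** Dual to [true_region]: extensions and intensions trade places, with meet and box taking the
    roles of join and diamond. *)
Lemma false_region :
  ranked_region Abelard (fun q => ~ true_position q) (rank Abelard).
Proof.
split.
- case=> // g phi fg _; have [m ni rm] := not_supports fg.
  have keep : moves (ObjPos g phi : position (eval_game V)) (FeatPos m phi) ->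
      ~~ keeps_formula Abelard (FeatPos m phi) ->
      keeps_formula Abelard (ObjPos g phi) ->
      exists2 q', moves (ObjPos g phi : position (eval_game V)) q' &
        ~ true_position q' /\ rank Abelard q' < rank Abelard (ObjPos g phi).
    move=> mv nk k; exists (FeatPos m phi); last split; last exact: rank_same.
      by [].
    by apply.
  case: phi fg rm keep => [|| p |phi1 phi2|phi1 phi2|psi|psi] fg rm keep.
  + by apply: keep => //; exists m.
  + by case: fg.
  + by apply: keep => //=; case: asboolP => // _; exists m.
  + have /not_andP[fg1|fg2] := fg.
      exists (ObjPos g phi1); first by left.
      by split=> //; apply: rank_smaller; rewrite ltnS leq_addr.
    exists (ObjPos g phi2); first by right.
    by split=> //; apply: rank_smaller; rewrite ltnS leq_addl.
  + by apply: keep => //; exists m.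
  + have /existsNP[n /not_implyP[rn nr]] := fg.
    exists (FeatPos n psi); first by exists n.
    by split=> //; apply: rank_smaller.
  + by apply: keep => //; exists m.
- case=> // m phi q' /contrapT rm _ mq.
  have keep : to_obj m phi q' ->
      (forall g, ~~ keeps_formula Abelard (ObjPos g phi)) ->
      keeps_formula Abelard (FeatPos m phi) ->
      ~ true_position q' /\ rank Abelard q' < rank Abelard (FeatPos m phi).
    case=> g ni <- nk k; split; last exact: rank_same.
    by move=> sg; apply: ni; apply: supports_refutes rm.
  case: phi rm mq keep => [|| p |phi1 phi2|phi1 phi2|psi|psi] rm mq keep;
    try exact: keep.
  + by move: mq => /=; case: asboolP.
  + have [rm1 rm2] : refutes V m phi1 /\ refutes V m phi2 := rm.
    case: mq => ->; split=> //; apply: rank_smaller.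
      by rewrite ltnS leq_addr.
    by rewrite ltnS leq_addl.
  + case: mq => g nr <-; split; last exact: rank_smaller.
    by move=> sg; apply: nr; apply: rm.
Qed.

End EvaluationGame.

Theorem theorem5 (Prp : countType) (F : enriched_context) (V : Prp -> concept F)
    (phi : formula Prp) :
  (forall g : obj F,
     supports V g phi <->
     @has_winning_strategy (eval_game V) Eloise (ObjPos g phi)) /\
  (forall m : feat F,
     ~ refutes V m phi <->
     @has_winning_strategy (eval_game V) Eloise (FeatPos m phi)).
Proof.
have truthP (q : position (eval_game V)) :
    true_position q <-> has_winning_strategy Eloise q.
  split; first exact/ranked_region_wins/true_region.
  (* Eloise is the opponent of Abelard, whose false region defeats all her strategies. *)
  apply: contraPP => Nq.
  exact: (ranked_region_defeats (false_region V)).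
split=> [g|m]; [exact: (truthP (ObjPos g phi))|exact: (truthP (FeatPos m phi))].
Qed.
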